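(* Consider the two-block problem $$\min\ f(x_1,x_2):=g(x_1,x_2)+h_1(x_1)+h_2(x_2)\quad\text{s.t. } x_1\in X_1,\ x_2\in X_2,$$ and suppose that the problem is convex, its global minimum is attained, $X\cap\mathrm{int}(\mathrm{dom}\,f)\ne\emptyset$ with $X=X_1\times X_2$, and that Assumption D holds: (a) for each $x_1\in X_1$ the problem $\min_{x_2\in X_2}f(x_1,x_2)$ has a unique solution; (b) $\|\nabla_1g(x_1,x_2)-\nabla_1g(v_1,x_2)\|\le M_1\|x_1-v_1\|$ for all $x_1,v_1\in X_1$, $x_2\in X_2$. Then the following hold. 1. Suppose $u_2(v_2;x)=g(x_1,v_2)$ for all $v_2\in X_2$, $x\in X$, and that $u_1(v_1;x)$ satisfies, for all $x\in X$ and $v_1,\hat v_1\in X_1$: $u_1(x_1;x)=g(x)$; $u_1(v_1;x)\ge g(v_1,x_2)$; $\nabla u_1(x_1;x)=\nabla_1g(x)$; and $\|\nabla u_1(v_1;x)-\nabla u_1(\hat v_1;x)\|\le L_1\|v_1-\hat v_1\|$ with a constant $L_1>0$ (gradients of $u_1$ being with respect to its first argument). Then the 2-block BSUM algorithm with G-S rule is equivalent to the SUM algorithm (in the sense given in the context) and converges sublinearly, i.e. $$\Delta^{r+1}\le\frac{c_4}{\sigma_4}\frac1r,\quad r\ge 1,\qquad \sigma_4=\frac{1}{32R^2L_1},\quad c_4=\max\{4\sigma_4-2,\ f(x^1)-f^*,\ 2\}.$$ 2. The BCM algorithm applied to the two-block problem (that is, the 2-block BSUM with $u_2(v_2;x)=g(x_1,v_2)$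 and $u_1(v_1;x)=g(v_1,x_2)$) converges sublinearly with the same rate, $L_1$ being the Lipschitz constant of the gradient of this $u_1$ in its first argument.
   Context: Setting: $g$ is smooth and convex, $h_1,h_2$ are convex, possibly nonsmooth and possibly extended-valued, $X_1,X_2$ are convex subsets of Euclidean spaces, $f$ is closed, proper, convex. $\nabla_1g$ is the partial gradient with respect to $x_1$; $\nabla_2g$ is not assumed Lipschitz. $f^*$ is the optimal value, $X^*$ the optimal solution set, $x^r=(x_1^r,x_2^r)$, $\Delta^r=f(x^r)-f^*$. $R=\max_{x\in X}\max_{x^*\in X^*}\{\|x-x^*\|: f(x)\le f(x^1)\}$; the level set $\{x:f(x)\le f(x^1)\}$ is assumed compact so that $R$ is finite; $R>0$ and finiteness of $f(x^r)$, $r\ge 1$, are understood. G-S 2-block BSUM algorithm: at each iteration $r+1$, $$x_2^{r+1}=\arg\min_{x_2\in X_2}u_2(x_2;x_1^r,x_2^r)+h_2(x_2),\qquad x_1^{r+1}\in\arg\min_{x_1\in X_1}u_1(x_1;x_1^r,x_2^{r+1})+h_1(x_1).$$ SUM algorithm: for a single-block problem $\min_{x\in X}\ell(x)+h(x)$ and a function $u(v;x)$ with $u(x;x)=\ell(x)$, $u(v;x)\ge\ell(v)$, $\nabla u(x;x)=\nabla\ell(x)$ and $\nabla u(\cdot;x)$ Lipschitz continuous uniformly in $x$, iterate $x^{r+1}\in\arg\min_{x\in X}u(x;x^r)+h(x)$. Equivalence: let $x_2^*(x_1)$ be the unique minimizer of $f(x_1,\cdot)$ over $X_2$, let $\ell(x_1)=\min_{x_2\in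 X_2}g(x_1,x_2)+h_2(x_2)$, and let $u(v_1;x_1)=u_1(v_1;x_1,x_2^*(x_1))+h_2(x_2^*(x_1))$. The 2-block BSUM is equivalent to SUM in the sense that $x_2^{r+1}=x_2^*(x_1^r)$ and the iterates $x_1^r$ are those of the SUM algorithm applied to $\min_{x_1\in X_1}\ell(x_1)+h_1(x_1)$ with this function $u$ (which satisfies the requirements on $u$ in the previous paragraph, with Lipschitz constant $L_1$). *)

(* Defs.v *)
From HB Require Import structures.
From mathcomp Require Import all_boot all_order all_algebra.
From mathcomp Require Import all_classical all_reals all_analysis.
Set Implicit Arguments.
Unset Strict Implicit.
Unset Printing Implicit Defensive.
Import Order.TTheory GRing.Theory Num.Theory.
Import numFieldNormedType.Exports.
Local Open Scope classical_set_scope.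
Local Open Scope ring_scope.

Section euclidean.
Context {R : realType}.

(* The library norm on ['rV[R]_n] and on products is the sup norm, which induces
   the same topology and differentials; all the metric quantities below use the
   Euclidean norm. *)
Definition enorm n (v : 'rV[R]_n) : R := Num.sqrt (\sum_i v 0 i ^+ 2).

Definition enorm2 n1 n2 (x : 'rV[R]_n1 * 'rV[R]_n2) : R :=
  Num.sqrt (enorm x.1 ^+ 2 + enorm x.2 ^+ 2).

(* Only meaningful where [f] is (Fréchet) differentiable, which is always
   required separately. *)
Definition grad n (f : 'rV[R]_n -> R) (x : 'rV[R]_n) : 'rV[R]_n :=
  \row_i 'D_(delta_mx 0 i) f x.

Definition elipschitz n m (A : set 'rV[R]_n) (F : 'rV[R]_n -> 'rV[R]_m)
    (L : R) : Prop :=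
  forall v w, A v -> A w -> enorm (F v - F w) <= L * enorm (v - w).

End euclidean.

Section convex_extended.
Context {R : realType}.
Local Open Scope ereal_scope.

(* Used for functions that never take the value -oo; there, this is convexity of
   the epigraph. *)
Definition econvex (V : lmodType R) (h : V -> \bar R) : Prop :=
  forall (x y : V) (t : R), (0 < t < 1)%R ->
    h (t *: x + (1 - t) *: y)%R <= t%:E * h x + (1 - t)%:E * h y.

Definition edom (V : Type) (f : V -> \bar R) : set V := [set x | f x < +oo].

Definition proper (V : Type) (f : V -> \bar R) : Prop :=
  (forall x, f x != -oo) /\ edom f !=set0.

Definition closed_proper_convex (V : normedModType R) (f : V -> \bar R) : Prop :=
  [/\ lower_semicontinuous f, proper f & econvex f].

Definition argmin (V : Type) (A : set V) (F : V -> \bar R) : set V :=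
  [set x | A x /\ forall y, A y -> F x <= F y].

End convex_extended.

Section sum_algorithm.
Context {R : realType} {n : nat}.
Implicit Types (A : set 'rV[R]_n) (l : 'rV[R]_n -> R).
Implicit Types (u : 'rV[R]_n -> 'rV[R]_n -> R).

(* [u v x] stands for u(v; x) *)
Definition sum_surrogate A l u (L : R) : Prop :=
  forall x, A x ->
    [/\ u x x = l x,
        (forall v, A v -> l v <= u v x),
        differentiable l x,
        (forall v, A v -> differentiable (u ^~ x) v) &
        grad (u ^~ x) x = grad l x /\ elipschitz A (grad (u ^~ x)) L].

(* Sequences are indexed from 1; the term of index 0 is not used. *)
Definition SUM A u (h : 'rV[R]_n -> \bar R) (x : nat -> 'rV[R]_n) : Prop :=
  forall r, (1 <= r)%N -> argmin A (fun v => (u v (x r))%:E + h v)%E (x r.+1).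

End sum_algorithm.

Section two_blocks.
Context {R : realType} {n1 n2 : nat}.
Local Notation V1 := 'rV[R]_n1.
Local Notation V2 := 'rV[R]_n2.
Context (X1 : set V1) (X2 : set V2) (g : V1 * V2 -> R).
Context (h1 : V1 -> \bar R) (h2 : V2 -> \bar R).

Definition grad1 (x : V1 * V2) : V1 := grad (fun v => g (v, x.2)) x.1.
Definition grad2 (x : V1 * V2) : V2 := grad (fun v => g (x.1, v)) x.2.

Definition smooth : Prop :=
  [/\ forall x, differentiable g x, continuous grad1 & continuous grad2].

Definition objective (x : V1 * V2) : \bar R :=
  ((g x)%:E + h1 x.1 + h2 x.2)%E.

(* f(x1, .) up to the term h1 x1, which does not depend on the second block.
   Dropping it only matters where h1 x1 = +oo: there the literal f(x1, .) is
   identically +oo and would have no unique minimizer unless X2 is a singleton. *)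
Definition block2_objective (x1 : V1) (y : V2) : \bar R :=
  ((g (x1, y))%:E + h2 y)%E.

Definition assumptionD (M1 : R) : Prop :=
  (forall x1, X1 x1 -> exists! y, argmin X2 (block2_objective x1) y) /\
  (forall y, X2 y -> elipschitz X1 (fun v => grad1 (v, y)) M1).

Definition x2star (x1 : V1) : V2 :=
  xget 0 (argmin X2 (block2_objective x1)).

(* A minimum when x1 is in X1. The infimum extends it outside X1, where the
   minimum need not be attained, so that its gradient at the boundary points of
   X1 makes sense. *)
Definition ell (x1 : V1) : R :=
  fine (ereal_inf (block2_objective x1 @` X2)).

Definition reduced_surrogate (u1 : V1 -> V1 * V2 -> R) (v1 x1 : V1) : R :=
  let y := x2star x1 in u1 v1 (x1, y) + fine (h2 y).

(* [u1 v x] stands for u_1(v; x) *)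
Definition block1_surrogate (u1 : V1 -> V1 * V2 -> R) (L1 : R) : Prop :=
  forall x, (X1 `*` X2) x ->
    [/\ u1 x.1 x = g x,
        (forall v, X1 v -> g (v, x.2) <= u1 v x),
        (forall v, X1 v -> differentiable (u1 ^~ x) v),
        grad (u1 ^~ x) x.1 = grad1 x &
        elipschitz X1 (grad (u1 ^~ x)) L1].

(* Sequences are indexed from 1; the term of index 0 is not used. *)
Definition BSUM (u1 : V1 -> V1 * V2 -> R) (u2 : V2 -> V1 * V2 -> R)
    (x : nat -> V1 * V2) : Prop :=
  forall r, (1 <= r)%N ->
    argmin X2 (fun y => (u2 y (x r))%:E + h2 y)%E = [set (x r.+1).2] /\
    argmin X1 (fun v => (u1 v ((x r).1, (x r.+1).2))%:E + h1 v)%E (x r.+1).1.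

Definition BCM (x : nat -> V1 * V2) : Prop :=
  BSUM (fun v z => g (v, z.2)) (fun y z => g (z.1, y)) x.

Definition fstar : \bar R :=
  ereal_inf (objective @` (X1 `*` X2)).

Definition Delta (x : nat -> V1 * V2) (r : nat) : \bar R :=
  (objective (x r) - fstar)%E.

(* A supremum, since the maximum need not be attained when X1 and X2 are not
   closed. *)
Definition radius (x1 : V1 * V2) : R :=
  let f := objective in
  sup [set d | exists x xs, [/\ (X1 `*` X2) x, argmin (X1 `*` X2) f xs,
                               (f x <= f x1)%E & d = enorm2 (x - xs)]].

Definition sigma4 (L1 : R) (x : nat -> V1 * V2) : R :=
  1 / (32 * radius (x 1%N) ^+ 2 * L1).

Definition c4 (L1 : R) (x : nat -> V1 * V2) : R :=
  Num.max (4 * sigma4 L1 x - 2)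
    (Num.max (fine (Delta x 1)) 2).

Definition admissible_start (x1 : V1 * V2) : Prop :=
  let f := objective in
  [/\ (X1 `*` X2) x1, edom f x1, compact [set x | (f x <= f x1)%E] &
      0 < radius x1].

Definition sublinear_rate (L1 : R) (x : nat -> V1 * V2) : Prop :=
  forall r, (1 <= r)%N ->
    (Delta x r.+1 <=
      (c4 L1 x / sigma4 L1 x * (1 / r%:R))%:E)%E.

End two_blocks.

(* Main.v *)
Require Import Defs.
From mathcomp Require Import all_boot all_order all_algebra.
From mathcomp Require Import all_classical all_reals all_analysis.
From mathcomp Require Import ring lra.
Import Order.TTheory GRing.Theory Num.Theory.
Import numFieldNormedType.Exports.
Set Implicit Arguments.
Unset Strict Implicit.
Unset Printing Implicit Defensive.
Local Open Scope classical_set_scope.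
Local Open Scope ring_scope.

(** Minimizing out the second block turns the two-block iteration into a
one-block one. Let [ell] be the value function obtained by minimizing
[g(x1, .) + h2] over [X2]. As [g] and [h2] are jointly convex, [ell] is convex,
and it is finite on the whole space: its minimum is attained at the points of
[X1], and a convex function that is nowhere [+oo] cannot take the value [-oo]
without being [-oo] everywhere. At a point [x1] of [X1], freezing the second block at its minimizer gives a differentiable function
of the first block that lies above [ell] and touches it at [x1]; a convex
function touched from above by a differentiable one is differentiable with the
same gradient ([differentiable_convex_touching]). This makes [ell] differentiable
at the points of [X1] ([ell_differentiable]) and shows that the surrogate reduced
to the first block is a surrogate of [ell] ([reduced_sum_surrogate]). The equivalence of the
two algorithms ([BSUM_SUM]) then only uses the uniqueness of the block minimizer
and the invariance of [argmin] under the addition of a constant.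

For the rate, compare the new iterate with the point [x + t (z - x)] of the
segment from the current iterate [x] to a minimizer [z]. The descent lemma for
functions with Lipschitz gradient bounds the surrogate there, the gradient
inequality for [ell] bounds its linear part, and convexity of [h1] bounds the
nonsmooth part; altogether ([SUM_step], [BSUM_step])
  Delta(r+1) <= (1 - t) Delta(r) + (L1 / 2) t^2 R^2   for every t in [0, 1],
where the case [t = 0] gives monotonicity, hence keeps the iterates in the
initial level set, on which distances to minimizers are at most [R]. Choosing
[t = 2 / (r + 1)] gives
Delta(r+1) <= 2 L1 R^2 / (r + 2) ([recursive_rate]). The bound of the theorem is
weaker: as [c4 >= 2], it is at least [64 L1 R^2 / r]. *)

(** * Euclidean geometry and the descent lemma *)

Section euclidean_space.
Context {R : realType} {n : nat}.
Implicit Types (u v x y : 'rV[R]_n) (A : set 'rV[R]_n) (f : 'rV[R]_n -> R).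

Definition dotp u v : R := \sum_i u 0 i * v 0 i.

Lemma enorm_ge0 v : 0 <= enorm v.
Proof. exact: sqrtr_ge0. Qed.

Lemma enorm_sqr v : enorm v ^+ 2 = dotp v v.
Proof.
rewrite sqr_sqrtr; first by apply: eq_bigr => i _; rewrite expr2.
by apply: sumr_ge0 => i _; rewrite sqr_ge0.
Qed.

Lemma dotpZr a u v : dotp u (a *: v) = a * dotp u v.
Proof. by rewrite /dotp mulr_sumr; apply: eq_bigr => i _; rewrite mxE mulrCA. Qed.

Lemma dotpBl u v w : dotp (u - v) w = dotp u w - dotp v w.
Proof.
by rewrite /dotp -sumrB; apply: eq_bigr => i _; rewrite !mxE mulrBl.
Qed.

Lemma enormZ a v : enorm (a *: v) = `|a| * enorm v.
Proof.
rewrite -sqrtr_sqr -sqrtrM ?sqr_ge0// mulr_sumr; congr Num.sqrt.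
by apply: eq_bigr => i _; rewrite mxE exprMn.
Qed.

(** Expanding the nonnegative number [ |<v,v> u - <u,v> v|^2 ] gives [<v,v>] times
the defect of the squared inequality. *)
Lemma CauchySchwarz_dotp u v : dotp u v <= enorm u * enorm v.
Proof.
apply: le_trans (ler_norm _) _.
rewrite -ler_sqr ?nnegrE ?mulr_ge0 ?enorm_ge0// real_normK ?num_real//.
rewrite exprMn !enorm_sqr.
have key : 0 <= dotp v v * (dotp u u * dotp v v - dotp u v ^+ 2).
  suff -> : dotp v v * (dotp u u * dotp v v - dotp u v ^+ 2)
      = \sum_i (dotp v v * u 0 i - dotp u v * v 0 i) ^+ 2.
    by apply: sumr_ge0 => i _; rewrite sqr_ge0.
  have -> : \sum_i (dotp v v * u 0 i - dotp u v * v 0 i) ^+ 2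
      = \sum_i (dotp v v ^+ 2 * (u 0 i * u 0 i)
         - 2 * dotp v v * dotp u v * (u 0 i * v 0 i)
         + dotp u v ^+ 2 * (v 0 i * v 0 i)).
    by apply: eq_bigr => i _; ring.
  rewrite big_split sumrB/= -!mulr_sumr -/(dotp _ _) -/(dotp _ _) -/(dotp _ _).
  ring.
have [v0|v0] := eqVneq (dotp v v) 0; last first.
  by move: key; rewrite pmulr_rge0 ?subr_ge0// lt0r v0 -enorm_sqr sqr_ge0.
suff -> : dotp u v = 0 by rewrite v0 expr0n mulr0.
have z i : v 0 i = 0.
  move/eqP : v0; rewrite /dotp psumr_eq0 => [/allP /(_ i)|j _].
    by rewrite mem_index_enum => /(_ isT)/=; rewrite -expr2 sqrf_eq0 => /eqP.
  by rewrite -expr2 sqr_ge0.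
by rewrite /dotp big1// => i _; rewrite z mulr0.
Qed.

(** The norm on the right is the sup norm of the topology: this transfers
boundedness of compact sets to the Euclidean norm. *)
Lemma enorm_le_norm v : enorm v <= Num.sqrt n%:R * `|v|.
Proof.
rewrite -[X in _ <= _ * X](@ger0_norm R)// -sqrtr_sqr -sqrtrM ?ler0n//.
apply: ler_wsqrtr.
suff : \sum_(i < n) v 0 i ^+ 2 <= \sum_(i < n) `|v| ^+ 2.
  by rewrite sumr_const card_ord mulr_natl.
apply: ler_sum => i _; rewrite -[v 0 i ^+ 2]real_normK ?num_real//.
rewrite ler_sqr ?nnegrE//.
rewrite [`|v|]mx_normrE.
exact: (@le_bigmax _ _ _ 0 (fun ij : 'I_1 * 'I_n => `|v ij.1 ij.2|) (0, i)).
Qed.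

Lemma diff_dotp f x v : differentiable f x -> 'd f x v = dotp (grad f x) v.
Proof.
move=> df; rewrite {1}(row_sum_delta v) linear_sum.
by apply: eq_bigr => i _; rewrite linearZ/= mxE deriveE// mulrC.
Qed.

Lemma convex_set_segment A x v t : convex_set A -> A x -> A v ->
  0 <= t <= 1 -> A (x + t *: (v - x)).
Proof.
move=> cA Ax Av /andP[t0 t1].
have -> : x + t *: (v - x) = t *: v + (1 - t) *: x.
  by rewrite scalerBl scale1r scalerBr addrCA.
by have := @cA v x (Itv01 t0 t1); rewrite !inE; apply.
Qed.

Lemma is_derive_segment f x d (t : R) : differentiable f (x + t *: d) ->
  is_derive t 1 (fun s => f (x + s *: d)) (dotp (grad f (x + t *: d)) d).
Proof.
move=> df; have E : (fun h : R => h^-1 *: (((fun s => f (x + s *: d)) \o shift t)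
     (h *: 1) - f (x + t *: d)))
  = (fun h : R => h^-1 *: ((f \o shift (x + t *: d)) (h *: d) - f (x + t *: d))).
  apply/funext => h; congr (_ *: (f _ - _)) => /=.
  by rewrite -[h *: 1]/(h * 1) mulr1 scalerDl addrCA.
apply: DeriveDef.
  by rewrite /derivable E; exact: diff_derivable.
by rewrite /derive E -diff_dotp// -deriveE.
Qed.

(** Along the segment from [x] to [v], subtracting the quadratic
[L / 2 * s ^+ 2 * enorm (v - x) ^+ 2] leaves a function [psi] of [s] whose
derivative never exceeds its value at [s = 0], because the gradient moves by at most
[L * s * enorm (v - x)]; the mean value theorem on [psi] concludes. Only
points of the convex set [A] are visited. *)
Lemma descent A f (L : R) x v : convex_set A ->
  (forall w, A w -> differentiable f w) -> elipschitz A (grad f) L ->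
  A x -> A v ->
  f v <= f x + dotp (grad f x) (v - x) + L / 2 * enorm (v - x) ^+ 2.
Proof.
move=> cA df lipf Ax Av; set d := v - x.
pose psi : R -> R :=
  (fun s => f (x + s *: d)) - (fun s : R => (L / 2 * enorm d ^+ 2) *: (s ^+ 2)).
have Aseg t : 0 <= t <= 1 -> A (x + t *: d) by exact: convex_set_segment.
pose dpsi (t : R) := dotp (grad f (x + t *: d)) d - L * enorm d ^+ 2 * t.
have dP (t : R) : 0 <= t <= 1 -> is_derive t 1 psi (dpsi t).
  move=> t01; have ? := is_derive_segment (df _ (Aseg _ t01)).
  apply: is_derive_eq; rewrite /dpsi; congr (_ - _).
  rewrite -![_ *: _]/(_ * _); lra.
have [||c c01] := @MVT R psi dpsi 0 1 ltr01.
- by move=> t; rewrite in_itv/= => /andP[t0 t1]; apply: dP; rewrite !ltW.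
- apply: continuous_in_subspaceT => t; rewrite inE/= in_itv/= => t01.
  apply/differentiable_continuous/derivable1_diffP.
  by have := dP _ t01 => -[].
have /andP[c0 c1] : 0 < c < 1 by move: c01; rewrite in_itv.
rewrite subr0 mulr1 /psi /dpsi !fctE scale1r scale0r addr0 expr1n expr0n/=.
rewrite scaler0 subr0 -![_ *: _]/(_ * _) mulr1 {1 2}/d addrCA subrr addr0 => E.
have Ac : A (x + c *: d) by apply: Aseg; rewrite !ltW.
have le1 : dotp (grad f (x + c *: d)) d - dotp (grad f x) d <= L * c * enorm d ^+ 2.
  rewrite -dotpBl; apply: le_trans (CauchySchwarz_dotp _ _) _.
  rewrite expr2 mulrA ler_wpM2r ?enorm_ge0//.
  apply: le_trans (lipf _ _ Ac Ax) _.
  by rewrite addrC addKr enormZ (gtr0_norm c0) mulrA.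
lra.
Qed.

End euclidean_space.

(** * Differentiability of convex functions *)

Section convex_differentiable.
Context {R : realType} {V : normedModType R}.
Implicit Types (f p : V -> R) (x y d : V).

Lemma convex_functionTP f : convex_function setT f <->
  forall x y t, 0 < t < 1 -> f (t *: x + (1 - t) *: y) <= t * f x + (1 - t) * f y.
Proof.
split=> [cf x y t /andP[t0 t1]|cf t x y _ _].
  by have := cf (Itv01 (ltW t0) (ltW t1)) x y; rewrite !inE; apply.
have [->|t0] := eqVneq t 0%:i01; first by rewrite !conv0.
have [->|t1] := eqVneq t 1%:i01; first by rewrite !conv1.
apply: (cf x y t%:num).
by rewrite !lt_neqAle t1 le1 andbT eq_sym t0 ge0.
Qed.

(** Convexity bounds every difference quotient at [x] along [y - x] with step
[0 < s < 1] by [f y - f x]; let [s] tend to [0]. *)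
Lemma convex_ge_tangent f x y : convex_function setT f -> differentiable f x ->
  f x + 'd f x (y - x) <= f y.
Proof.
move=> /convex_functionTP cf df; rewrite -deriveE// addrC -lerBrDr.
set q := fun s : R => s^-1 *: ((f \o shift x) (s *: (y - x)) - f x).
(* The bound on the quotients holds for positive steps, hence the one-sided
   limit. *)
have qr : q s @[s --> 0^'+] --> 'D_(y - x) f x.
  apply: cvg_trans (diff_derivable df); apply: cvg_app => A.
  rewrite !nbhs_simpl/= /dnbhs /at_right /within/=.
  by apply: filterS => s As s0; apply: As; rewrite gt_eqF.
rewrite -(cvg_lim _ qr)//; apply: limr_le; first exact: cvgP qr.
near=> s; rewrite /q -[_ *: _]/(_ * _) /=.
have s01 : 0 < s < 1.
  by apply/andP; split; near: s; [exact: nbhs_right_gt|exact: nbhs_right_lt].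
rewrite ler_pdivrMl; last by case/andP: s01.
have := cf y x _ s01.
have -> : s *: y + (1 - s) *: x = s *: (y - x) + x.
  by rewrite scalerBr scalerBl scale1r addrCA addrC.
lra.
Unshelve. all: by end_near. Qed.

(** The upper bound on [f (x + h)] is the expansion of [p]. The lower bound comes
from the upper bound at the opposite point, since convexity gives
[2 * f x <= f (x + h) + f (x - h)]. *)
Lemma differentiable_convex_touching f p x : convex_function setT f ->
  (forall y, f y <= p y) -> f x = p x -> differentiable p x ->
  differentiable f x /\ 'd f x = 'd p x :> (V -> R).
Proof.
move=> /convex_functionTP cf fp fpx dp.
have [cdp /eqaddoP op] := (diff_locallyP _ _).1 dp.
have mid h : 2 * f x <= f (h + x) + f (- h + x).
  have half01 : 0 < (2^-1 : R) < 1 by apply/andP; split; lra.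
  have := cf (h + x) (- h + x) _ half01.
  have -> : 1 - 2^-1 = 2^-1 :> R by lra.
  have -> : 2^-1 *: (h + x) + 2^-1 *: (- h + x) = x.
    rewrite -scalerDr addrACA subrr add0r -mulr2n -[x *+ 2]scaler_nat scalerA.
    by rewrite mulVf ?scale1r// pnatr_eq0.
  lra.
have E : f \o shift x = cst (f x) + 'd p x +o_ 0 id.
  apply/eqaddoP => e e0; have /nbhs_ballP[r r0 opr] := op e e0.
  near=> h.
  have hr : `|h| < r by near: h; exact: nbhs0_lt.
  have /opr/ler_normlP[+ +] : ball 0 r h by rewrite -ball_normE/= sub0r normrN.
  have /opr/ler_normlP[+ +] : ball 0 r (- h) by rewrite -ball_normE/= sub0r opprK.
  rewrite !fctE/= linearN normrN.
  have := mid h; have := fp (h + x); have := fp (- h + x).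
  rewrite -fpx => ? ? ? ? ? ? ?; apply/ler_normlP; split; lra.
have Ed := diff_unique cdp E.
split; last exact: Ed.
by apply/diff_locallyP; split; rewrite Ed; [exact: cdp|exact: E].
Unshelve. all: by end_near. Qed.

End convex_differentiable.

(** * Extended-valued convex functions and minimizers *)

Section extended_real_functions.
Context {R : realType}.

Lemma eq_argmin (V : Type) (A : set V) (F G : V -> \bar R) :
  (forall x, A x -> F x = G x) -> argmin A F = argmin A G.
Proof.
move=> FG; apply/seteqP; split=> x [Ax xm]; split=> // y Ay.
  by rewrite -!FG// xm.
by rewrite !FG// xm.
Qed.

Lemma argmin_addr (V : Type) (A : set V) (F : V -> R) (h : V -> \bar R) c :
  argmin A (fun v => ((F v + c)%:E + h v)%E) = argmin A (fun v => (F v)%:E + h v)%E.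
Proof.
have E v : ((F v + c)%:E + h v = c%:E + ((F v)%:E + h v))%E.
  by rewrite EFinD addeAC [RHS]addeC.
by apply/seteqP; split=> x [Ax xm]; split=> // y Ay; have := xm y Ay;
  rewrite !E leeD2lE.
Qed.

(** Finite values make the extended arithmetic harmless and let the convexity
inequality reach the endpoints [t = 0] and [t = 1]. *)
Lemma econvex_fine (V : lmodType R) (h : V -> \bar R) x y t : econvex h ->
  h x \is a fin_num -> h y \is a fin_num -> 0 <= t <= 1 ->
  (h (t *: x + (1 - t) *: y)%R <= (t * fine (h x) + (1 - t) * fine (h y))%:E)%E.
Proof.
move=> ch hx hy t01; rewrite EFinD !EFinM !fineK//.
have [->|t0] := eqVneq t 0.
  by rewrite scale0r add0r subr0 scale1r mul0e add0e mul1e.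
have [->|t1] := eqVneq t 1.
  by rewrite subrr scale0r addr0 scale1r mul0e adde0 mul1e.
by apply: ch; rewrite !lt_neqAle t1 eq_sym t0.
Qed.

End extended_real_functions.

(** * One step of the single-block algorithm and the resulting rate *)

Section sum_descent.
Context {R : realType} {n : nat}.

(** The minimality of [x'] is tested against the point [x + t *: (z - x)], where the
surrogate is controlled by the descent lemma. The linear term involves the
gradient of [l], by which convexity bounds [t * (l z - l x)] from below. The left-hand
side is the surrogate value rather than [l x' + h x'], as it also dominates
the two-block objective. *)
Lemma SUM_step (A : set 'rV[R]_n) (l : 'rV[R]_n -> R) u L h x x' z t :
  convex_set A -> convex_function setT l -> sum_surrogate A l u L ->
  econvex h -> A x -> A z -> h x \is a fin_num -> h z \is a fin_num ->
  argmin A (fun v => (u v x)%:E + h v)%E x' -> 0 <= t <= 1 ->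
  ((u x' x)%:E + h x' <= ((1 - t) * (l x + fine (h x))
     + t * (l z + fine (h z)) + L / 2 * t ^+ 2 * enorm (z - x) ^+ 2)%:E)%E.
Proof.
move=> cA cl su ch Ax Az hx hz [Ax' x'min] t01.
have [uxx _ dl du [gul lipu]] := su _ Ax.
have Aw : A (x + t *: (z - x)) by exact: convex_set_segment.
apply: le_trans (x'min _ Aw) _.
have := descent cA du lipu Ax Aw.
have -> : x + t *: (z - x) - x = t *: (z - x) by rewrite addrC addKr.
rewrite gul dotpZr enormZ exprMn real_normK ?num_real// uxx -lee_fin => uw.
have lz := convex_ge_tangent z cl dl; rewrite diff_dotp// in lz.
have hw : (h (x + t *: (z - x))%R <= (t * fine (h z) + (1 - t) * fine (h x))%:E)%E.
  have -> : x + t *: (z - x) = t *: z + (1 - t) *: x.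
    by rewrite scalerBl scale1r scalerBr addrCA.
  exact: econvex_fine.
apply: le_trans (leeD uw hw) _; rewrite -EFinD lee_fin.
have /andP[t0 t1] := t01; have := ler_wpM2l t0 lz.
lra.
Qed.

(** The choice [t = 2 / (r + 1)] in the bound on [a r.+1] works by induction: for
[r = 1] it is [t = 1], which forgets [a 1], and for [r = q + 1] the induction step
amounts to [(q + 1) * (q + 3) <= (q + 2) ^+ 2]. *)
Lemma recursive_rate (a : nat -> R) (K : R) : 0 <= K ->
  (forall r t, (1 <= r)%N -> 0 <= t <= 1 ->
     a r.+1 <= (1 - t) * a r + K / 2 * t ^+ 2) ->
  forall r, (1 <= r)%N -> a r.+1 <= 2 * K / (r%:R + 2).
Proof.
move=> K0 rec; elim=> // -[_ _|r IH _].
  have := rec 1%N 1 isT; rewrite lexx ler01 => /(_ isT).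
  have -> : 2 * K / (1%:R + 2) = 2 / 3 * K by field.
  lra.
set q : R := r.+1%:R in IH *.
have q0 : 0 <= q by rewrite ler0n.
have -> : r.+2%:R = q + 1 by rewrite -natr1.
have q2 : 0 < q + 2 by lra.
have t01 : 0 <= 2 / (q + 2) <= 1.
  by apply/andP; split; [apply: divr_ge0; lra|rewrite ler_pdivrMr; lra].
apply: le_trans (rec r.+2 _ isT t01) _.
have : (1 - 2 / (q + 2)) * a r.+2 <= (1 - 2 / (q + 2)) * (2 * K / (q + 2)).
  by rewrite ler_wpM2l ?IH//; case/andP: t01; lra.
suff : (1 - 2 / (q + 2)) * (2 * K / (q + 2)) + K / 2 * (2 / (q + 2)) ^+ 2
   <= 2 * K / (q + 1 + 2) by lra.
have -> : (1 - 2 / (q + 2)) * (2 * K / (q + 2)) + K / 2 * (2 / (q + 2)) ^+ 2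
  = 2 * K * ((q + 1) / (q + 2) ^+ 2) by field; lra.
rewrite ler_wpM2l//; first lra.
rewrite ler_pdivrMr ?exprn_gt0// ler_pdivlMl; nra.
Qed.

End sum_descent.

(** * The value function of the second block *)

Section two_blocks.
Context {R : realType} {n1 n2 : nat}.
Local Notation V1 := 'rV[R]_n1.
Local Notation V2 := 'rV[R]_n2.
Context (X1 : set V1) (X2 : set V2) (g : V1 * V2 -> R).
Context (h1 : V1 -> \bar R) (h2 : V2 -> \bar R).
Context (cX1 : convex_set X1) (cX2 : convex_set X2).
Context (dg : forall x, differentiable g x) (cg : convex_function setT g).
Context (ch1 : econvex h1) (ch2 : econvex h2).
Local Notation f := (objective g h1 h2).
Context (f_proper : forall x, f x != -oo%E).
Context (f_dom : exists2 x, (X1 `*` X2) x & (f x < +oo)%E).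
Context (uniq2 : forall x1, X1 x1 -> exists! y, argmin X2 (block2_objective g h2 x1) y).

Local Notation value x1 := (ereal_inf (block2_objective g h2 x1 @` X2)).

Lemma h2_neq_ninfty y : h2 y != -oo%E.
Proof.
by apply/eqP => h2y; have /eqP := f_proper (0, y); rewrite /f/= h2y addeNy.
Qed.

Lemma objective_fin x : (f x < +oo)%E ->
  h1 x.1 \is a fin_num /\ h2 x.2 \is a fin_num.
Proof.
move=> fx; have : f x \is a fin_num by rewrite fin_numE f_proper -ltey.
by rewrite /f !fin_numD => /andP[/andP[_ ->] ->].
Qed.

Lemma block2_objective_fin x1 y : (block2_objective g h2 x1 y < +oo)%E ->
  h2 y \is a fin_num.
Proof.
rewrite fin_numE h2_neq_ninfty/= /block2_objective.
by case: (h2 y).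
Qed.

Lemma h2_dom : exists2 y, X2 y & h2 y \is a fin_num.
Proof.
by have [x [_ X2x] /objective_fin[_ h2x]] := f_dom; exists x.2.
Qed.

Lemma value_lty x1 : (value x1 < +oo)%E.
Proof.
have [y X2y h2y] := h2_dom; apply: (@le_lt_trans _ _ (block2_objective g h2 x1 y)).
  by apply: ereal_inf_lbound; exists y.
by rewrite /block2_objective -(fineK h2y) -EFinD ltry.
Qed.

(** Convexity is expressed through the strict epigraph, which makes sense even
where the infimum is [-oo] and lets near-minimizers replace minimizers; it can
thus serve to show that the infimum is finite. *)
Lemma value_convex x z a b t : 0 < t < 1 ->
  (value x < a%:E)%E -> (value z < b%:E)%E ->
  (value (t *: x + (1 - t) *: z) < (t * a + (1 - t) * b)%:E)%E.
Proof.
move=> t01 /ereal_inf_ltP[_ [y X2y <-] ya] /ereal_inf_ltP[_ [w X2w <-] wb].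
have h2y := block2_objective_fin (lt_trans ya (ltry _)).
have h2w := block2_objective_fin (lt_trans wb (ltry _)).
have /andP[t0 t1] := t01.
have X2c : X2 (t *: y + (1 - t) *: w).
  by have := @cX2 y w (Itv01 (ltW t0) (ltW t1)); rewrite !inE; apply.
apply: le_lt_trans (ereal_inf_lbound _) _; first by exists (t *: y + (1 - t) *: w).
have t01w : 0 <= t <= 1 by rewrite !ltW.
have h2c := econvex_fine ch2 h2y h2w t01w.
have gc := (convex_functionTP _).1 cg (x, y) (z, w) t t01.
rewrite -lee_fin in gc; apply: le_lt_trans (leeD gc h2c) _.
move: ya wb; rewrite /block2_objective -(fineK h2y) -(fineK h2w) -!EFinD !lte_fin/=.
move=> ya wb; have t1' : 0 < 1 - t by rewrite subr_gt0.
have := ltr_pM2l t0 (g (x, y) + fine (h2 y)) a.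
have := ltr_pM2l t1' (g (z, w) + fine (h2 w)) b.
rewrite ya wb; lra.
Qed.

Lemma x2star_argmin x1 : X1 x1 ->
  argmin X2 (block2_objective g h2 x1) (x2star X2 g h2 x1).
Proof. by move=> /uniq2 [y [ym _]]; apply: xgetPex; exists y. Qed.

Lemma argmin_x2star x1 : X1 x1 ->
  argmin X2 (block2_objective g h2 x1) = [set x2star X2 g h2 x1].
Proof.
move=> X1x; apply/seteqP; split=> [y ym|_ ->]; last exact: x2star_argmin.
have [w [_ wm]] := uniq2 X1x.
by rewrite /= -(wm _ ym); apply: wm; exact: x2star_argmin.
Qed.

Lemma value_x2star x1 : X1 x1 ->
  value x1 = block2_objective g h2 x1 (x2star X2 g h2 x1).
Proof.
move=> /x2star_argmin[X2y ym]; apply/eqP; rewrite eq_le; apply/andP; split.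
  by apply: ereal_inf_lbound; exists (x2star X2 g h2 x1).
by apply: le_ereal_inf_tmp => _ [w X2w <-]; exact: ym.
Qed.

Lemma h2_x2star x1 : X1 x1 -> h2 (x2star X2 g h2 x1) \is a fin_num.
Proof.
by move=> X1x; apply: (@block2_objective_fin x1); rewrite -value_x2star// value_lty.
Qed.

(** A value [-oo] at [x] would propagate to any point [x0] of [X1], which is the
midpoint of [x] and of its reflection [z] through [x0]; but there the infimum is
attained, hence finite. *)
Lemma value_fin x : value x \is a fin_num.
Proof.
have [[x0 y0] [X1x0 _] _] := f_dom; rewrite fin_numE -ltey value_lty andbT.
apply/eqP => vx.
have [r v0] : exists r, value x0 = r%:E.
  exists (fine (value x0)); rewrite fineK//.
  by rewrite value_x2star// /block2_objective fin_numD h2_x2star.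
pose z := x0 + (x0 - x).
have [b vzb] : exists b, (value z < b%:E)%E.
  have := value_lty z; case: (value z) => [s _|//|_]; last by exists 0; rewrite ltNyr.
  by exists (s + 1); rewrite lte_fin ltrDl.
have half01 : 0 < (2^-1 : R) < 1 by apply/andP; split; lra.
(* The first bound is chosen so that the midpoint inequality reads [r < r]. *)
have vxa : (value x < (2 * r - b)%:E)%E by rewrite vx ltNyr.
have := value_convex half01 vxa vzb.
have -> : 2^-1 *: x + (1 - 2^-1) *: z = x0.
  by apply/rowP => i; rewrite !mxE; field.
by rewrite v0 lte_fin; lra.
Qed.

Local Notation l := (ell X2 g h2).

Lemma ellE x : (l x)%:E = value x.
Proof. by rewrite fineK// value_fin. Qed.

Lemma ell_convex : convex_function setT l.
Proof.
apply/convex_functionTP => x z t t01; rewrite -lee_fin; apply/lee_addgt0Pr => e e0.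
have lt_l w : (value w < (l w + e)%:E)%E by rewrite -ellE lte_fin ltrDl.
have := value_convex t01 (lt_l x) (lt_l z); rewrite -ellE -EFinD => /ltW /le_trans; apply.
by rewrite lee_fin; lra.
Qed.

Lemma ell_le x y : X2 y -> h2 y \is a fin_num -> l x <= g (x, y) + fine (h2 y).
Proof.
move=> X2y h2y; rewrite -lee_fin ellE EFinD fineK//.
by apply: ereal_inf_lbound; exists y.
Qed.

Lemma ell_x2star x : X1 x ->
  l x = g (x, x2star X2 g h2 x) + fine (h2 (x2star X2 g h2 x)).
Proof.
by move=> X1x; apply: EFin_inj; rewrite ellE value_x2star// EFinD fineK ?h2_x2star.
Qed.

Lemma differentiable_block1 x y : differentiable (fun v => g (v, y)) x.
Proof.
exact: (@differentiable_comp _ _ _ _ (fun v => (v, y)) g).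
Qed.

Lemma grad_addr (p : V1 -> R) c x : grad (fun v => p v + c) x = grad p x.
Proof.
apply/rowP => i; rewrite !mxE /derive.
set q := (fun _ : R => _); set q' := (fun _ : R => _).
suff -> : q = q' by [].
by apply/funext => s; rewrite /q /q' /= opprD addrACA subrr addr0.
Qed.

(** The objective with the second block frozen at [x2star x] lies above the value
function and touches it at [x]. *)
Lemma ell_differentiable x : X1 x ->
  differentiable l x /\ grad l x = grad1 g (x, x2star X2 g h2 x).
Proof.
move=> X1x; have [X2y _] := x2star_argmin X1x; set y := x2star _ _ _ x in X2y *.
pose p v := g (v, y) + fine (h2 y).
have dp : differentiable p x.
  apply: (@differentiableD _ _ _ (fun v => g (v, y)) (cst (fine (h2 y)))).
    exact: differentiable_block1.
  exact: differentiable_cst.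
have lp v : l v <= p v by apply: ell_le X2y _; exact: h2_x2star.
have [dl dlp] :=
  differentiable_convex_touching ell_convex lp (ell_x2star X1x) dp.
split; first exact: dl.
rewrite /grad1 -[RHS](grad_addr _ (fine (h2 y))).
by apply/rowP => i; rewrite !mxE (deriveE _ dl) dlp -(deriveE _ dp).
Qed.

(** * Reduction of the two-block algorithm to the single-block one *)

Section surrogate.
Context (u1 : V1 -> V1 * V2 -> R) (L1 : R).
Context (su1 : block1_surrogate X1 X2 g u1 L1).
Local Notation u := (reduced_surrogate X2 g h2 u1).

(** The reduced surrogate differs by a constant from the surrogate of the first block
at [(x, x2star x)]; its gradient at [x] is the partial gradient of [g] there,
which is the gradient of the value function. *)
Lemma reduced_sum_surrogate : sum_surrogate X1 l u L1.
Proof.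
move=> x X1x; have [X2y _] := x2star_argmin X1x; have h2y := h2_x2star X1x.
have [dl gl] := ell_differentiable X1x.
rewrite /reduced_surrogate; set y := x2star _ _ _ x in X2y h2y gl *.
have [/= u1x u1_ge du1 gu1 lipu1] := su1 (conj X1x X2y : (X1 `*` X2) (x, y)).
split.
- by rewrite u1x ell_x2star.
- by move=> v X1v; apply: le_trans (ell_le _ X2y h2y) _; rewrite lerD2r u1_ge.
- exact: dl.
- move=> v X1v.
  apply: (@differentiableD _ _ _ (u1 ^~ (x, y)) (cst (fine (h2 y)))).
    exact: du1.
  exact: differentiable_cst.
- split=> [|v w X1v X1w]; rewrite !grad_addr; first exact: etrans gu1 (esym gl).
  exact: lipu1.
Qed.

(** Both sides keep the iterates in [X1 `*` X2], which is what identifies [u2] with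
[g] at the current iterate. *)
Lemma BSUM_SUM u2 x :
  (forall v2 x, X2 v2 -> (X1 `*` X2) x -> u2 v2 x = g (x.1, v2)) ->
  (X1 `*` X2) (x 1%N) ->
  BSUM X1 X2 h1 h2 u1 u2 x <->
  (forall r, (1 <= r)%N -> (x r.+1).2 = x2star X2 g h2 (x r).1) /\
  SUM X1 u h1 (fun r => (x r).1).
Proof.
move=> u2E Xx1.
have block2 z : (X1 `*` X2) z ->
    argmin X2 (fun y => (u2 y z)%:E + h2 y)%E = [set x2star X2 g h2 z.1].
  move=> Xz; rewrite -argmin_x2star; last by case: Xz.
  by apply: eq_argmin => y X2y; rewrite u2E.
have block1 z1 : argmin X1 (fun v => (u v z1)%:E + h1 v)%E =
    argmin X1 (fun v => (u1 v (z1, x2star X2 g h2 z1))%:E + h1 v)%E.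
  exact: argmin_addr.
split=> [bs|[x2 sm]].
  have Xx r : (1 <= r)%N -> (X1 `*` X2) (x r).
    case: r => // -[//|r] _; have [e [X1x _]] := bs r.+1 isT; split=> //.
    by have : [set (x r.+2).2] (x r.+2).2 by []; rewrite -e => -[].
  have x2 r : (1 <= r)%N -> (x r.+1).2 = x2star X2 g h2 (x r).1.
    move=> r1; have [e _] := bs r r1.
    by have : [set (x r.+1).2] (x r.+1).2 by []; rewrite -e (block2 _ (Xx r r1)).
  by split=> // r r1; rewrite block1 -x2//; have [] := bs r r1.
have Xx r : (1 <= r)%N -> (X1 `*` X2) (x r).
  elim: r => // -[//|r] IH _; have [X1x _] := sm r.+1 isT; split=> //.
  rewrite x2//; have [X1r _] := IH isT.
  by have [] := x2star_argmin X1r.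
move=> r r1; rewrite (block2 _ (Xx r r1)) x2//; split=> //.
by have := sm r r1; rewrite block1.
Qed.

Lemma ell_le_objective p : (X1 `*` X2) p -> (f p < +oo)%E ->
  l p.1 + fine (h1 p.1) <= fine (f p).
Proof.
case: p => p1 p2 [/= _ X2p] /objective_fin[/= h1p h2p].
rewrite -lee_fin fineK; last by rewrite /objective !fin_numD/= h1p h2p.
rewrite /objective/= -(fineK h1p) -(fineK h2p) -!EFinD lee_fin.
by have := ell_le p1 X2p h2p; lra.
Qed.

(** The single-block step bounds the reduced surrogate at [x1'], which dominates the
objective at the new pair; the value function is dominated by the objective at
[p] and at [z]. Taking [t = 0] gives monotonicity. *)
Lemma BSUM_step p z x1' t : (X1 `*` X2) p -> (X1 `*` X2) z ->
  (f p < +oo)%E -> (f z < +oo)%E ->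
  argmin X1 (fun v => (u v p.1)%:E + h1 v)%E x1' -> 0 <= t <= 1 ->
  (f (x1', x2star X2 g h2 p.1) <= ((1 - t) * fine (f p) + t * fine (f z)
     + L1 / 2 * t ^+ 2 * enorm (z.1 - p.1) ^+ 2)%:E)%E.
Proof.
move=> Xp Xz fp fz x1'P t01.
have [X1p _] := Xp; have [X1z _] := Xz; have [X1x' _] := x1'P.
have [h1p _] := objective_fin fp; have [h1z _] := objective_fin fz.
have step := SUM_step cX1 ell_convex reduced_sum_surrogate ch1 X1p X1z h1p h1z x1'P t01.
have h2y := h2_x2star X1p; have [X2y _] := x2star_argmin X1p.
have [_ /(_ _ X1x')/= u1_ge _ _ _] := su1 (conj X1p X2y : (X1 `*` X2) (p.1, x2star X2 g h2 p.1)).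
apply: (@le_trans _ _ ((u x1' p.1)%:E + h1 x1')%E).
  rewrite /objective/= addeAC -{1}(fineK h2y) -EFinD leeD2r// lee_fin.
  by rewrite /reduced_surrogate lerD2r.
apply: le_trans step _; rewrite lee_fin lerD2r.
have /andP[t0 t1] := t01.
by apply: lerD; apply: ler_wpM2l; rewrite ?subr_ge0//; exact: ell_le_objective.
Qed.

End surrogate.

End two_blocks.

(** * Sublinear convergence *)

Section rate.
Context {R : realType} {n1 n2 : nat}.
Local Notation V1 := 'rV[R]_n1.
Local Notation V2 := 'rV[R]_n2.
Context (X1 : set V1) (X2 : set V2) (g : V1 * V2 -> R).
Context (h1 : V1 -> \bar R) (h2 : V2 -> \bar R).
Local Notation f := (objective g h1 h2).

Lemma fstar_argmin z : argmin (X1 `*` X2) f z -> fstar X1 X2 g h1 h2 = f z.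
Proof.
move=> [Xz zm]; apply/eqP; rewrite eq_le; apply/andP; split.
  by apply: ereal_inf_lbound; exists z.
by apply: le_ereal_inf_tmp => _ [w Xw <-]; exact: zm.
Qed.

(** Minimizers lie in the initial level set, so its compactness makes the supremum
defining the radius that of a bounded set. *)
Lemma enorm_radius x1 p z : (X1 `*` X2) x1 -> compact [set x | (f x <= f x1)%E] ->
  (X1 `*` X2) p -> (f p <= f x1)%E -> argmin (X1 `*` X2) f z ->
  enorm (z.1 - p.1) <= Defs.radius X1 X2 g h1 h2 x1.
Proof.
move=> Xx1 cK Xp fp zm.
apply: (@le_trans _ _ (enorm2 (p - z))).
  rewrite -[leLHS](@ger0_norm R) ?enorm_ge0// -sqrtr_sqr; apply: ler_wsqrtr.
  by rewrite -opprB -scaleN1r enormZ normrN1 mul1r lerDl sqr_ge0.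
apply: ub_le_sup; last by exists p, z.
have [M [Mr bM]] := compact_bounded cK.
have {}bM w : (f w <= f x1)%E -> `|w| <= M + 1 by apply: bM; rewrite ltrDl.
have bc (m : nat) (v w : 'rV[R]_m) : `|v| <= M + 1 -> `|w| <= M + 1 ->
    enorm (v - w) <= Num.sqrt m%:R * (2 * (M + 1)).
  move=> vM wM; apply: le_trans (enorm_le_norm _) _.
  by rewrite ler_wpM2l ?sqrtr_ge0//; apply: le_trans (ler_normB _ _) _; lra.
exists (Num.sqrt ((Num.sqrt n1%:R * (2 * (M + 1))) ^+ 2
               + (Num.sqrt n2%:R * (2 * (M + 1))) ^+ 2)).
move=> _ [[v1 v2] [[w1 w2] [Xv [Xw wm] fv ->]]].
have fw := wm _ Xx1.
have := bM _ fv; have := bM _ fw; rewrite !prod_normE/= !ge_max.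
move=> /andP[bw1 bw2] /andP[bv1 bv2].
have e1 := bc _ _ _ bv1 bw1; have e2 := bc _ _ _ bv2 bw2.
apply: ler_wsqrtr => /=.
apply: lerD; rewrite ler_sqr ?nnegrE ?enorm_ge0 ?(le_trans (enorm_ge0 _))//.
- exact: le_trans (enorm_ge0 _) e1.
- exact: le_trans (enorm_ge0 _) e2.
Qed.

Context (cX1 : convex_set X1) (cX2 : convex_set X2).
Context (dg : forall x, differentiable g x) (cg : convex_function setT g).
Context (ch1 : econvex h1) (ch2 : econvex h2).
Context (f_proper : forall x, f x != -oo%E).
Context (f_argmin : argmin (X1 `*` X2) f !=set0).
Context (uniq2 : forall x1, X1 x1 -> exists! y, argmin X2 (block2_objective g h2 x1) y).

Lemma BSUM_rate u1 u2 L1 x :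
  (forall v2 x, X2 v2 -> (X1 `*` X2) x -> u2 v2 x = g (x.1, v2)) ->
  0 < L1 -> block1_surrogate X1 X2 g u1 L1 ->
  admissible_start X1 X2 g h1 h2 (x 1%N) -> BSUM X1 X2 h1 h2 u1 u2 x ->
  sublinear_rate X1 X2 g h1 h2 L1 x.
Proof.
move=> u2E L10 su1 [Xx1 fx1 cK R0] bs.
have [z zm] := f_argmin; have [Xz zmin] := zm.
have fz : (f z < +oo)%E by exact: le_lt_trans (zmin _ Xx1) fx1.
have f_dom : exists2 w, (X1 `*` X2) w & (f w < +oo)%E by exists z.
have [x2 sm] := (BSUM_SUM h1 uniq2 u1 u2E Xx1).1 bs.
set rho := Defs.radius X1 X2 g h1 h2 (x 1%N) in R0.
have f_fin w : (f w < +oo)%E -> f w \is a fin_num.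
  by move=> fw; rewrite fin_numE f_proper -ltey.
have step r t : (1 <= r)%N -> (X1 `*` X2) (x r) -> (f (x r) < +oo)%E -> 0 <= t <= 1 ->
    (f (x r.+1) <= ((1 - t) * fine (f (x r)) + t * fine (f z)
     + L1 / 2 * t ^+ 2 * enorm (z.1 - (x r).1) ^+ 2)%:E)%E.
  move=> r1 Xr fr t01; rewrite [x r.+1]surjective_pairing x2//.
  by apply: (BSUM_step cX1 cX2 dg cg ch1 ch2 f_proper f_dom uniq2 su1) => //; exact: sm.
(* Monotonicity, the case [t = 0] of the step, keeps the iterates in the initial
   level set. *)
have inv r : (1 <= r)%N -> (X1 `*` X2) (x r) /\ (f (x r) <= f (x 1%N))%E.
  elim: r => // -[//|r] IH _; have [Xr fr] := IH isT.
  have frfin := le_lt_trans fr fx1; split.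
    split; first by have [] := sm r.+1 isT.
    by rewrite x2//; have [X1r _] := Xr; have [] := x2star_argmin uniq2 X1r.
  apply: le_trans fr; rewrite -[leRHS](fineK (f_fin _ frfin)).
  have := step r.+1 0 isT Xr frfin; rewrite lexx ler01 => /(_ isT).
  by rewrite subr0 mul1r mul0r addr0 expr0n/= mulr0 mul0r addr0.
have frfin r : (1 <= r)%N -> (f (x r) < +oo)%E.
  by move=> /inv[_ fr]; exact: le_lt_trans fr fx1.
pose a r := fine (f (x r)) - fine (f z).
have arec r t : (1 <= r)%N -> 0 <= t <= 1 ->
    a r.+1 <= (1 - t) * a r + (L1 * rho ^+ 2) / 2 * t ^+ 2.
  move=> r1 t01; have [Xr fr] := inv r r1.
  have := step r t r1 Xr (frfin r r1) t01.
  rewrite -[leLHS](fineK (f_fin _ (frfin r.+1 isT))) lee_fin => st.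
  have := enorm_radius Xx1 cK Xr fr zm; rewrite -/rho.
  rewrite -ler_sqr ?nnegrE ?enorm_ge0 ?(ltW R0)// => nr.
  have := ler_wpM2l (_ : 0 <= L1 / 2 * t ^+ 2) nr.
  rewrite mulr_ge0 ?divr_ge0 ?(ltW L10)// ?sqr_ge0// => /(_ isT).
  by rewrite /a; lra.
have K0 : 0 <= L1 * rho ^+ 2 by rewrite mulr_ge0 ?sqr_ge0 ?ltW.
move=> r r1; have := recursive_rate K0 arec r1.
rewrite /Delta (fstar_argmin zm) -(fineK (f_fin _ (frfin r.+1 isT))).
rewrite -(fineK (f_fin _ fz)) -EFinB lee_fin => /le_trans; apply.
have q0 : 0 < r%:R :> R by rewrite ltr0n.
have s0 : 0 < sigma4 X1 X2 g h1 h2 L1 x.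
  by rewrite divr_gt0// !mulr_gt0// exprn_gt0.
have c2 : 2 <= c4 X1 X2 g h1 h2 L1 x by rewrite !le_max lexx !orbT.
apply: (@le_trans _ _ (2 / sigma4 X1 X2 g h1 h2 L1 x * (1 / r%:R))); last first.
  by rewrite !ler_wpM2r ?divr_ge0 ?invr_ge0 ?(ltW s0)// ltW.
rewrite /sigma4 -/rho.
have -> : 2 / (1 / (32 * rho ^+ 2 * L1)) * (1 / r%:R) = 64 * (L1 * rho ^+ 2) / r%:R.
  by field; rewrite !gt_eqF.
apply: ler_pM; [lra|by rewrite invr_ge0; lra|lra|].
by rewrite lef_pV2 ?posrE; lra.
Qed.

End rate.

Theorem corollary5p1 (R : realType) (n1 n2 : nat)
    (X1 : set 'rV[R]_n1) (X2 : set 'rV[R]_n2)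
    (g : 'rV[R]_n1 * 'rV[R]_n2 -> R)
    (h1 : 'rV[R]_n1 -> \bar R) (h2 : 'rV[R]_n2 -> \bar R) (M1 : R) :
  convex_set X1 -> convex_set X2 ->
  smooth g -> convex_function setT g ->
  econvex h1 -> econvex h2 ->
  closed_proper_convex (objective g h1 h2) ->
  argmin (X1 `*` X2) (objective g h1 h2) !=set0 ->
  (X1 `*` X2) `&` (edom (objective g h1 h2))° !=set0 ->
  assumptionD X1 X2 g h2 M1 ->
  (forall (u1 : 'rV[R]_n1 -> 'rV[R]_n1 * 'rV[R]_n2 -> R)
          (u2 : 'rV[R]_n2 -> 'rV[R]_n1 * 'rV[R]_n2 -> R) (L1 : R),
     (forall v2 x, X2 v2 -> (X1 `*` X2) x -> u2 v2 x = g (x.1, v2)) ->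
     0 < L1 ->
     block1_surrogate X1 X2 g u1 L1 ->
     [/\ sum_surrogate X1 (ell X2 g h2) (reduced_surrogate X2 g h2 u1) L1,
         (forall x : nat -> 'rV[R]_n1 * 'rV[R]_n2, (X1 `*` X2) (x 1%N) ->
            BSUM X1 X2 h1 h2 u1 u2 x <->
            (forall r, (1 <= r)%N -> (x r.+1).2 = x2star X2 g h2 (x r).1) /\
            SUM X1 (reduced_surrogate X2 g h2 u1) h1 (fun r => (x r).1)) &
         (forall x : nat -> 'rV[R]_n1 * 'rV[R]_n2,
            admissible_start X1 X2 g h1 h2 (x 1%N) ->
            BSUM X1 X2 h1 h2 u1 u2 x ->
            sublinear_rate X1 X2 g h1 h2 L1 x)]) /\
  (forall L1 : R,
     0 < L1 ->
     (forall x, (X1 `*` X2) x ->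
        elipschitz X1 (grad (fun v => g (v, x.2))) L1) ->
     forall x : nat -> 'rV[R]_n1 * 'rV[R]_n2,
       admissible_start X1 X2 g h1 h2 (x 1%N) ->
       BCM X1 X2 g h1 h2 x ->
       sublinear_rate X1 X2 g h1 h2 L1 x).
Proof.
move=> cX1 cX2 [dg _ _] cg ch1 ch2 [_ [f_proper _] _] f_argmin f_int [uniq2 _].
have f_dom : exists2 w, (X1 `*` X2) w & (objective g h1 h2 w < +oo)%E.
  by have [w [Xw /interior_subset]] := f_int; exists w.
split=> [u1 u2 L1 u2E L10 su1|L1 L10 lip x start bcm].
  split.
  - exact: reduced_sum_surrogate.
  - by move=> x; exact: BSUM_SUM.
  - by move=> x; exact: BSUM_rate.
apply: BSUM_rate bcm => //.
by move=> [p1 p2] Xp; split=> //= [v _|]; [exact: differentiable_block1|exact: lip Xp].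
Qed.
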